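(* Let $\Delta\ge 0$ be an integer and let $G$ be a $(\geq 1)$-subdivision of a graph with maximum degree $\Delta$. Then $$\pi_{\mathrm{ch}}(G) \leq \lceil 5.22\, \Delta\rceil.$$
   Context: All graphs are finite, simple and undirected. A path is a sequence $(v_1,\dots,v_t)$ of pairwise distinct vertices with $v_iv_{i+1}$ an edge for each $i$. Given a colouring $\phi$ of the vertices, a sequence $(v_1,\dots,v_{2t})$ is $\phi$-repetitive if $\phi(v_i)=\phi(v_{t+i})$ for all $i\in\{1,\dots,t\}$. A colouring is (path-)nonrepetitive if no path is repetitive. A $k$-list-assignment $L$ of $G$ assigns to each vertex $v$ a set $L(v)$ with $|L(v)|\ge k$; an $L$-colouring is a colouring $\phi$ with $\phi(v)\in L(v)$ for all $v$. The nonrepetitive list chromatic number $\pi_{\mathrm{ch}}(G)$ is the minimum $k$ such that $G$ has a nonrepetitive $L$-colouring for every $k$-list-assignment $L$. A subdivision of a graph $H$ replaces each edge $vw$ by a path from $v$ to $w$, these paths being internally disjoint; it is a $(\geq d)$-subdivision if each such path has at least $d$ internal (division) vertices.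
   Formalization: The formal theorem assumes Δ ≥ 1 instead of Δ ≥ 0: for Δ = 0 the bound is 0, which fails for every graph with a vertex (e.g. K_1 has π_ch = 1). *)

(* Defs.v *)
From HB Require Import structures.
From mathcomp Require Import all_boot all_order all_algebra.
From mathcomp Require Import boolp classical_sets functions cardinality.

Set Implicit Arguments.
Unset Strict Implicit.
Unset Printing Implicit Defensive.

Record sgraph := SGraph {
  vertex :> finType;
  edge : rel vertex;
  edge_sym : symmetric edge;
  edge_irr : irreflexive edge }.

Definition degree (G : sgraph) (v : G) : nat := #|[pred w | edge v w]|.

Definition maxdeg (G : sgraph) : nat := \max_(v : G) degree v.

Definition is_path (G : sgraph) (s : seq G) : bool :=
  uniq s && sorted (@edge G) s.

(* [t > 0] is required, since the empty sequence would otherwise be a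
   repetitive path in every graph; [x] is only the default value of [nth]. *)
Definition repetitive (V C : Type) (phi : V -> C) (s : seq V) : Prop :=
  exists t : nat, [/\ (0 < t)%N, size s = (2 * t)%N &
    forall (x : V) (i : nat), (i < t)%N ->
      phi (nth x s i) = phi (nth x s (t + i))].

Definition nonrepetitive (G : sgraph) (C : Type) (phi : G -> C) : Prop :=
  forall s : seq G, is_path s -> ~ repetitive phi s.

(* Lists may be infinite, over an arbitrary type of colours. *)
Definition list_assignment (k : nat) (G : sgraph) (C : Type)
    (L : G -> set C) : Prop :=
  forall v : G, (`I_k #<= L v)%card.

Definition list_colouring (G : sgraph) (C : Type) (L : G -> set C)
    (phi : G -> C) : Prop :=
  forall v : G, L v (phi v).

Definition nonrep_choosable (k : nat) (G : sgraph) : Prop :=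
  forall (C : Type) (L : G -> set C), list_assignment k L ->
    exists phi : G -> C, list_colouring L phi /\ nonrepetitive phi.

Lemma injective_nonrepetitive (G : sgraph) (C : Type) (phi : G -> C) :
  injective phi -> nonrepetitive phi.
Proof.
move=> phi_inj s /andP[s_uniq _] [t [t_gt0 s_size rep]].
case: s s_uniq s_size rep => [|x s] s_uniq s_size rep.
  by move: s_size t_gt0; case: t {rep}.
have /phi_inj/eqP := rep x 0 t_gt0.
rewrite addn0 nth_uniq ?s_size //; last by rewrite ltn_Pmull.
  by rewrite eq_sym; move: t_gt0; case: t {s_size rep}.
by rewrite muln_gt0.
Qed.

Lemma nonrep_choosable_exists (G : sgraph) :
  exists k : nat, `[< nonrep_choosable k G >].
Proof.
exists #|G|; apply/asboolP => C0 L0 L0card.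
pose C : choiceType := {classic C0}.
have [f fP] : {f : G -> nat -> C & forall v,
    (forall i, (i < #|G|)%N -> L0 v (f v i)) /\
    {in gtn #|G| &, injective (f v)}}.
  apply: (@choice G (nat -> C) (fun v g =>
    (forall i, (i < #|G|)%N -> L0 v (g i)) /\
    {in gtn #|G| &, injective g})) => v.
  have /card_leP[g] := L0card v.
  have inI i : (i < #|G|)%N -> i \in `I_#|G| by move=> ?; apply/mem_set.
  have G_gt0 : (0 < #|G|)%N by apply/card_gt0P; exists v.
  pose h i : set_type (L0 v) :=
    g (insubd (SigSub (inI 0 G_gt0) : set_type `I_#|G|) i).
  exists (fun i => val (h i)); split=> [i _|i j].
    by apply/set_mem/(valP (h i)).
  rewrite !inE => i_lt j_lt /val_inj/(@inj _ _ _ g _ _ (in_setT _) (in_setT _)).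
  by move/(congr1 val); rewrite !insubdK ?(inI i) ?(inI j).
suff [phi [phiL phi_inj]] : exists phi : G -> C,
    list_colouring L0 phi /\ {in enum G &, injective phi}.
  exists phi; split=> //; apply: injective_nonrepetitive => x y.
  by apply: phi_inj; rewrite mem_enum.
have : (size (enum G) <= #|G|)%N by rewrite -cardE.
elim: (enum G) (enum_uniq G) => [_ _|v s IHs /= /andP[vNs s_uniq] s_lt].
  exists (f^~ 0); split=> // v; apply: (fP v).1.
  by apply/card_gt0P; exists v.
have [phi [phiL phi_inj]] := IHs s_uniq (ltnW s_lt).
have [fvL fv_inj] := fP v.
have [i i_lt fviN] : exists2 i, (i < #|G|)%N & f v i \notin map phi s.
  apply: contrapT => nex.
  have : {subset mkseq (f v) #|G| <= map phi s}.
    move=> c /mapP[i]; rewrite mem_iota /= add0n => i_lt ->.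
    by apply: contrapT => /negP fviN; apply: nex; exists i.
  move/uniq_leq_size; rewrite size_mkseq size_map leqNgt s_lt => /(_ _)/notF.
  apply; rewrite map_inj_in_uniq ?iota_uniq// => i j.
  by rewrite !mem_iota /= !add0n; apply: fv_inj.
exists (fun x => if x == v then f v i else phi x); split.
  by move=> x; case: eqP => [->|_]; [apply: fvL|apply: phiL].
move=> x y; rewrite !inE.
have [->|xv] := eqVneq x v; have [->|yv] := eqVneq y v => //= xs ys.
- by move=> e; case/negP: fviN; rewrite e map_f.
- by move=> e; case/negP: fviN; rewrite -e map_f.
- exact: phi_inj.
Qed.

Definition pi_ch (G : sgraph) : nat := ex_minn (nonrep_choosable_exists G).

(* [b] embeds the vertices of [H] in [G], and [P v w] lists the division
   vertices of the edge [vw] from [b v] to [b w]; [P] is unconstrained on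
   non-adjacent pairs. *)
Definition is_subdivision (d : nat) (H G : sgraph) : Prop :=
  exists (b : H -> G) (P : H -> H -> seq G),
    [/\ injective b,
        (forall v w, edge v w ->
          [/\ P w v = rev (P v w), (d <= size (P v w))%N, uniq (P v w)
            & forall u, b u \notin P v w]),
        (forall v w v' w' x, edge v w -> edge v' w' ->
          x \in P v w -> x \in P v' w' -> [set v; w]%SET = [set v'; w']%SET),
        (forall x, (exists v, x = b v)
          \/ (exists v w, edge v w /\ x \in P v w))
      & (forall x y, edge x y <->
          exists v w, edge v w
            /\ infix [:: x; y] (b v :: rcons (P v w) (b w)))].

(* Since [0]-list-assignments allow empty lists, the bound [ceil (5.22 * Delta)]
   fails at [Delta = 0] for every graph with a vertex: [Delta > 0] is needed. *)
Lemma pi_ch_gt0 (G : sgraph) (v : G) : (0 < pi_ch G)%N.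
Proof.
rewrite /pi_ch; case: ex_minnP => -[|//] /asboolP ch0 _.
have [] := ch0 unit (fun=> set0); last by move=> phi [/(_ v)].
by move=> w; rewrite II0; apply: card_ge0.
Qed.

(* Main.v *)
(** Rosenfeld's counting argument.  Let [l] be the list size and [N(S)] the
    number of nonrepetitive list colourings of [G[S]].  One shows
    [N(S + v) >= beta N(S)] by induction on [S]: among the [l N(S)] extensions
    to [v], those with a repetitive path of order [2k] through [v] are
    determined by the path and by the colouring outside the half containing
    [v], so there are at most [beta^(1-k) N(S)] of them per path.

    In a (>= 1)-subdivision at most every second step of a path branches, so
    at most [k Delta^k] paths of order [2k] contain [v] when [Delta >= 2], and
    [beta = (11/4) Delta] works since
    [11/4 + sum_k k (4/11)^(k-1) = 11/4 + 121/49 < 5.22].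

    When [Delta = 1] this bound fails at division vertices, which lie on up to
    [2k] such paths.  There [G] is a disjoint union of paths, so one colours
    each component from one end to the other: only one path of order [2k] ends
    at [v], and [beta = 2] works with four colours.  To cover both cases the
    induction runs over a family [ok] of vertex sets. *)

Require Import Defs.
From mathcomp Require Import boolp classical_sets functions cardinality.
From mathcomp Require Import all_boot all_order all_algebra.
From mathcomp Require Import zify ring lra.

Set Implicit Arguments.
Unset Strict Implicit.
Unset Printing Implicit Defensive.

Import Order.TTheory GRing.Theory Num.Theory.

(** * Counting colourings *)

Lemma card_le_sum_cover (T : finType) (I : eqType) (r : seq I)
    (F : I -> {set T}) (X : {set T}) :
  (forall x, x \in X -> exists2 i, i \in r & x \in F i) ->
  #|X| <= \sum_(i <- r) #|F i|.
Proof.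
elim: r X => [|i r IHr] X cov.
  rewrite big_nil leqn0 cards_eq0 -subset0.
  by apply/subsetP => x /cov[].
rewrite big_cons -(cardsID (F i) X) leq_add //.
  by rewrite subset_leq_card ?subsetIr.
apply: IHr => x; rewrite inE => /andP[xNF /cov[j]].
by rewrite inE => /orP[/eqP->|jr xF]; [rewrite (negPf xNF) | exists j].
Qed.

Lemma repetitive_rev (V C : Type) (phi : V -> C) (s : seq V) :
  repetitive phi s -> repetitive phi (rev s).
Proof.
move=> [t [t0 sz rep]]; exists t; rewrite size_rev; split=> // x i it.
rewrite !nth_rev ?sz; try lia.
have -> : 2 * t - i.+1 = t + (t - i.+1) by lia.
have -> : 2 * t - (t + i).+1 = t - i.+1 by lia.
by rewrite -rep //; lia.
Qed.

Lemma is_path_rev (G : sgraph) (s : seq G) : is_path (rev s) = is_path s.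
Proof.
rewrite /is_path rev_uniq rev_sorted; congr (_ && _).
by apply: eq_sorted => x y; exact: edge_sym.
Qed.

Section Counting.

Variables (G : sgraph) (C : Type) (l : nat) (f : G -> 'I_l.+1 -> C).
Hypothesis f_inj : forall v, injective (f v).

Implicit Types (S T B : {set G}) (c : {ffun G -> 'I_l.+1}) (s h : seq G).

(** Colourings are stored as positions in the lists, so that they form a finite type and can be
    counted even when [C] is arbitrary. *)
Definition fcol c (x : G) : C := f x (c x).

Definition nonrep_on S c : Prop :=
  forall s, is_path s -> {subset s <= S} -> ~ repetitive (fcol c) s.

(* Colourings of [S] are total functions set to [ord0] outside [S]. *)
Definition vanishes_off S c : bool :=
  [forall x, (x \notin S) ==> (c x == ord0)].

Definition colourings S : {set {ffun G -> 'I_l.+1}} :=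
  [set c | `[< nonrep_on S c >] && vanishes_off S c].

Lemma vanishes_offP S c :
  reflect (forall x, x \notin S -> c x = ord0) (vanishes_off S c).
Proof.
apply: (iffP forallP) => [H x xS|H x]; last by apply/implyP => /H ->.
by have /implyP/(_ xS)/eqP := H x.
Qed.

Lemma colouringsP S c :
  reflect (nonrep_on S c /\ vanishes_off S c) (c \in colourings S).
Proof.
by rewrite inE; apply: (iffP andP) => -[/asboolP].
Qed.

Lemma nonrep_on_eq S c c' :
  {in S, c =1 c'} -> nonrep_on S c -> nonrep_on S c'.
Proof.
move=> ecc nr s ps sS [t [t0 sz rep]]; apply: (nr s ps sS).
exists t; split=> // x i it; have := rep x i it.
by rewrite /fcol !ecc //; apply: sS; apply: mem_nth; rewrite sz; lia.
Qed.

Lemma nonrep_onS S B c : B \subset S -> nonrep_on S c -> nonrep_on B c.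
Proof. by move=> /subsetP BS nr s ps sB; apply: nr => // x /sB/BS. Qed.

(** Nonrepetitiveness is asked on [S] only, so a member outside [colourings (v |: S)] has a
    repetitive path through [v]. *)
Definition extensions S v : {set {ffun G -> 'I_l.+1}} :=
  [set c | `[< nonrep_on S c >] && vanishes_off (v |: S) c].

Lemma card_extensions S v : v \notin S ->
  l.+1 * #|colourings S| <= #|extensions S v|.
Proof.
move=> vS.
(* Overwriting the value at [v] loses nothing, because colourings of [S] vanish at [v]. *)
pose g (p : {ffun G -> 'I_l.+1} * 'I_l.+1) : {ffun G -> 'I_l.+1} :=
  [ffun x => if x == v then p.2 else p.1 x].
have gv c i : g (c, i) v = i by rewrite ffunE eqxx.
have gN c i x : x != v -> g (c, i) x = c x by rewrite ffunE => /negPf->.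
have -> : l.+1 * #|colourings S| = #|setX (colourings S) [set: 'I_l.+1]|.
  by rewrite cardsX cardsT card_ord mulnC.
rewrite -(@card_in_imset _ _ g).
  apply/subset_leq_card/subsetP => c' /imsetP[[c i]].
  rewrite in_setX in_setT andbT => /colouringsP[nr /vanishes_offP vc] ->.
  rewrite inE; apply/andP; split.
    apply/asboolP; apply: nonrep_on_eq nr => x xS.
    by rewrite gN //; apply: contraNneq vS => <-.
  apply/vanishes_offP => x; rewrite in_setU1 negb_or => /andP[xv xS].
  by rewrite gN ?vc.
move=> [c i] [c' i']; rewrite !in_setX !in_setT !andbT.
move=> /colouringsP[_ /vanishes_offP vc] /colouringsP[_ /vanishes_offP vc'] e.
have -> : i = i' by rewrite -(gv c i) e gv.
congr (_, _); apply/ffunP => x; have [->|xv] := eqVneq x v.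
  by rewrite vc ?vc'.
by rewrite -(gN c i x xv) e gN.
Qed.

Definition path_half v k s : seq G :=
  if v \in take k s then take k s else drop k s.

Lemma mem_path_half v k s : v \in s -> v \in path_half v k s.
Proof.
rewrite /path_half; case: ifP => // vt.
by rewrite -{1}(cat_take_drop k s) mem_cat vt.
Qed.

Lemma path_half_sub v k s : {subset path_half v k s <= s}.
Proof.
rewrite /path_half => x.
by case: ifP => _; [apply: mem_take|apply: mem_drop].
Qed.

Lemma size_path_half v k s : size s = 2 * k -> size (path_half v k s) = k.
Proof.
move=> sz; rewrite /path_half; case: ifP => _.
  by rewrite size_takel // sz leq_pmull.
by rewrite size_drop sz mul2n -addnn addnK.
Qed.

(* On a repetitive path the colours of one half determine those of the other. *)
Lemma card_repetitive_extensions S v k s :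
  uniq s -> v \in s -> size s = 2 * k ->
  #|[set c in extensions S v | `[< repetitive (fcol c) s >]]|
    <= #|colourings ((v |: S) :\: [set x in path_half v k s])|.
Proof.
move=> us vs sz; set h := path_half v k s; set X := [set c in _ | _].
have vh : v \in h by apply: mem_path_half.
(* [g] erases the half containing [v]; each erased colour is recovered from the vertex at the same
   position in the other half. *)
pose g c : {ffun G -> 'I_l.+1} := [ffun x => if x \in h then ord0 else c x].
have gN c x : x \notin h -> g c x = c x by rewrite ffunE => /negPf->.
have partner x : x \in h -> exists2 y, y \notin h & forall c,
    repetitive (fcol c) s -> fcol c x = fcol c y.
  have ut : uniq (take k s ++ drop k s) by rewrite cat_take_drop.
  move: ut; rewrite cat_uniq => /and3P[_ /hasPn dis _].
  have st : size (take k s) = k by rewrite size_takel // sz leq_pmull.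
  have sd : size (drop k s) = k by rewrite size_drop sz mul2n -addnn addnK.
  rewrite /h /path_half; case: ifP => _ xh.
    have xk : index x (take k s) < k.
      by rewrite -[ltnRHS]st index_mem.
    exists (nth x s (k + index x (take k s))).
      by apply: dis; rewrite -nth_drop mem_nth // sd.
    move=> c [t [t0 sz' rep]]; have ek : t = k by lia.
    rewrite ek in rep; rewrite -(rep x _ xk); congr (fcol c _).
    by rewrite -[LHS](nth_index x xh) nth_take.
  have xk : index x (drop k s) < k.
    by rewrite -[ltnRHS]sd index_mem.
  exists (nth x s (index x (drop k s))).
    apply/negP => /dis.
    by rewrite -(nth_take _ xk) mem_nth // st.
  move=> c [t [t0 sz' rep]]; have ek : t = k by lia.
  rewrite ek in rep; rewrite (rep x _ xk); congr (fcol c _).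
  by rewrite -[LHS](nth_index x xh) nth_drop.
rewrite -(@card_in_imset _ _ g).
  apply/subset_leq_card/subsetP => c' /imsetP[c].
  rewrite !inE => /andP[/andP[/asboolP nr /vanishes_offP vc] _] ->.
  apply/andP; split.
    apply/asboolP; apply: (@nonrep_on_eq _ c).
      by move=> x; rewrite !inE => /andP[xh _]; rewrite gN.
    apply: nonrep_onS nr; apply/subsetP => x; rewrite !inE.
    by move=> /andP[xh /orP[/eqP xv|//]]; rewrite xv vh in xh.
  apply/vanishes_offP => x; rewrite !inE negb_and negbK => H.
  by rewrite ffunE; case: ifP H => //= _ H; rewrite vc // !inE.
move=> c c'; rewrite !inE => /andP[_ /asboolP rc] /andP[_ /asboolP rc'] e.
have eN x : x \notin h -> c x = c' x by move=> xh; rewrite -(gN c) // e gN.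
apply/ffunP => x; have [/partner[y yh py]|/eN//] := boolP (x \in h).
apply: (@f_inj x); rewrite -/(fcol c x) -/(fcol c' x) (py _ rc) (py _ rc').
by rewrite /fcol eN.
Qed.

Variables (P : G -> nat -> seq (seq G)) (Nk : nat -> nat) (ok : pred {set G}).
Variables (R : realFieldType) (beta : R).
Hypothesis beta_gt0 : (0 < beta)%R.
Hypothesis size_P : forall v k, size (P v k) <= Nk k.

(* [P v k] lists the paths of order [2k + 2] through [v], up to reversal. *)
Hypothesis P_cover : forall S v s k, ok S -> ok (v |: S) -> v \notin S ->
  is_path s -> v \in s -> {subset s <= v |: S} -> size s = 2 * k.+1 ->
  s \in P v k \/ rev s \in P v k.
(** The induction hypothesis is applied to the set left after deleting a half, which must therefore
    stay in the family. *)
Hypothesis ok_half : forall S v s k, ok S -> ok (v |: S) -> v \notin S ->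
  is_path s -> v \in s -> {subset s <= v |: S} -> size s = 2 * k.+1 ->
  ok ((v |: S) :\: [set x in path_half v k.+1 s]).
(** Iterated, this leads from [S] down to [B] one vertex at a time within the family. *)
Hypothesis ok_acc : forall S B, ok S -> ok B -> B \proper S ->
  exists2 x, x \in S :\: B & ok (S :\ x).
(** Partial sums stand for the series. The exponent is [k], not [k.+1]: a half has [k.+1] vertices,
    but one of them is [v], which is not in [S]. *)
Hypothesis beta_le : forall n,
  (beta + \sum_(k < n) (Nk k)%:R / beta ^+ k <= l.+1%:R)%R.

(** The induction hypothesis compares [S] with all its admissible subsets, because deleting a half
    removes several vertices at once. *)
Lemma colourings_extend S v : ok S -> ok (v |: S) -> v \notin S ->
  (forall B, ok B -> B \subset S ->
    (#|colourings B|%:R * beta ^+ #|S :\: B| <= #|colourings S|%:R)%R) ->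
  (beta * #|colourings S|%:R <= #|colourings (v |: S)|%:R)%R.
Proof.
move=> okS okT vS IH; set T := v |: S.
pose good s k := [&& is_path s, v \in s, all [in T] s & size s == 2 * k.+1].
pose bad s := [set c in extensions S v | `[< repetitive (fcol c) s >]].
(* [P v k] may contain sequences that are not paths in [T]; they are discarded so that [ok_half]
   applies to the rest. *)
pose r k := [seq s <- P v k | good s k].
have cov c : c \in extensions S v :\: colourings T ->
    exists2 s, s \in flatten [seq r k | k <- iota 0 #|G|] & c \in bad s.
  rewrite in_setD => /andP[cN cE].
  have : ~ nonrep_on T c.
    move=> nr; case/negP: cN; apply/colouringsP; split=> //.
    by move: cE; rewrite inE => /andP[].
  move=> /existsNP[s /not_implyP[ps /not_implyP[sT /contrapT rep]]].
  have vs : v \in s.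
    apply: contrapT => /negP vNs.
    move: cE; rewrite inE => /andP[/asboolP nr _]; apply: (nr s ps) rep => x xs.
    have := sT x xs; rewrite in_setU1 => /orP[/eqP xv|//].
    by rewrite -xv xs in vNs.
  have [t [t0 sz _]] := rep; case: t t0 sz => // k _ sz.
  have kG : k < #|G|.
    have : size s <= #|G|.
      by case/andP: ps => us _; rewrite -(card_uniqP us) max_card.
    lia.
  have [s' [s'P g' rep']] : exists s', [/\ s' \in P v k, good s' k &
      repetitive (fcol c) s'].
    have [sP|sP] := P_cover okS okT vS ps vs sT sz.
      by exists s; split=> //; rewrite /good ps vs sz eqxx andbT; apply/allP.
    exists (rev s); split=> //; last exact: repetitive_rev.
    rewrite /good is_path_rev ps mem_rev vs size_rev sz eqxx andbT all_rev.
    exact/allP.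
  exists s'; last by rewrite inE cE; apply/asboolP.
  apply/flattenP; exists (r k); last by rewrite mem_filter g'.
  by apply: map_f; rewrite mem_iota.
have /card_le_sum_cover := cov; rewrite big_flatten big_map.
rewrite -[#|G|]subn0 -/(index_iota 0 #|G|) big_mkord => le_bad.
have bad_le k s : s \in r k ->
    (#|bad s|%:R <= #|colourings S|%:R / beta ^+ k :> R)%R.
  rewrite mem_filter => /andP[/and4P[ps vs /allP sT /eqP sz] _].
  have us : uniq s by case/andP: ps.
  have okB := ok_half okS okT vS ps vs sT sz.
  set B := _ :\: _ in okB.
  have vh : v \in path_half v k.+1 s by apply: mem_path_half.
  have BS : B \subset S.
    apply/subsetP => x; rewrite !inE => /andP[xh /orP[/eqP xv|//]].
    by rewrite xv vh in xh.
  have SB : #|S :\: B| = k.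
    have uh : uniq (path_half v k.+1 s).
      by rewrite /path_half; case: ifP => _; rewrite ?take_uniq ?drop_uniq.
    have -> : S :\: B = [set x in path_half v k.+1 s] :\ v.
      apply/setP => x; rewrite !inE.
      have [->|xv] /= := eqVneq x v; first by rewrite (negPf vS) andbF.
      case xh: (x \in path_half v k.+1 s) => /=; last by rewrite andNb.
      by have := sT _ (path_half_sub xh); rewrite in_setU1 (negPf xv).
    have := cardsD1 v [set x in path_half v k.+1 s].
    rewrite inE vh cardsE (card_uniqP uh) (size_path_half v sz); lia.
  have := IH B okB BS; rewrite SB -ler_pdivlMr ?exprn_gt0 //.
  apply: le_trans; rewrite ler_nat.
  exact: card_repetitive_extensions.
have sub : #|extensions S v| <=
    #|extensions S v :\: colourings T| + #|colourings T|.
  rewrite -(cardsID (colourings T)) addnC leq_add2l.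
  by rewrite subset_leq_card ?subsetIr.
have ext := leq_trans (card_extensions vS) sub.
have {}ext := leq_trans ext (leq_add le_bad (leqnn _)).
move: ext; rewrite -(ler_nat R) natrM natrD natr_sum => ext.
have sum_le : (\sum_(k < #|G|) (\sum_(s <- r k) #|bad s|)%:R
    <= #|colourings S|%:R * \sum_(k < #|G|) (Nk k)%:R / beta ^+ k :> R)%R.
  rewrite mulr_sumr; apply: ler_sum => k _; rewrite natr_sum.
  apply: (@le_trans _ _ (\sum_(s <- r k) (#|colourings S|%:R / beta ^+ k)))%R.
    by rewrite big_seq [leRHS]big_seq; apply: ler_sum => s /bad_le.
  rewrite big_const_seq count_predT iter_addr_0 -[leLHS]mulr_natl mulrCA.
  rewrite ler_wpM2l ?ler0n // ler_wpM2r ?invr_ge0 ?(ltW (exprn_gt0 _ _)) //.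
  by rewrite ler_nat (leq_trans _ (size_P v k)) // size_filter count_size.
have := ler_wpM2l (ler0n R #|colourings S|) (beta_le #|G|).
rewrite mulrDr; lra.
Qed.

(** Induction on the size of [S]: a vertex outside [B] is peeled off, and the statement for the
    smaller set and all its admissible subsets feeds [colourings_extend]. *)
Lemma colourings_sub_le S B : ok S -> ok B -> B \subset S ->
  (#|colourings B|%:R * beta ^+ #|S :\: B| <= #|colourings S|%:R)%R.
Proof.
move: {2}#|S| (leqnn #|S|) B => n; elim: n S => [|n IHn] S Sn B okS okB BS.
  move: Sn BS; rewrite leqn0 cards_eq0 => /eqP->; rewrite subset0 => /eqP->.
  by rewrite setD0 cards0 expr0 mulr1.
have [eBS|pBS] := eqVproper BS.
  by rewrite eBS setDv cards0 expr0 mulr1.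
have [x] := ok_acc okS okB pBS; rewrite in_setD => /andP[xB xS] okSx.
have eS : S = x |: (S :\ x) by rewrite setD1K.
have BSx : B \subset S :\ x.
  apply/subsetP => y yB; rewrite !inE (subsetP BS) // andbT.
  by apply: contraNneq xB => <-.
have Sxn : #|S :\ x| <= n by move: Sn; rewrite (cardsD1 x) xS.
have step : (beta * #|colourings (S :\ x)|%:R <= #|colourings S|%:R)%R.
  rewrite [X in (_ <= #|colourings X|%:R)%R]eS; apply: colourings_extend => //.
  - by rewrite -eS.
  - by rewrite !inE eqxx.
  - by move=> B' okB' B'S; apply: IHn.
apply: le_trans step.
have -> : #|S :\: B| = #|(S :\ x) :\: B|.+1.
  rewrite (cardsD1 x) in_setD xB xS add1n; congr _.+1.
  by apply: eq_card => y; rewrite !inE andbCA.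
by rewrite exprS mulrCA ler_pM2l //; apply: IHn.
Qed.

(** The empty set has the zero colouring, so [colourings_sub_le] with [B] empty makes the count for
    the whole graph positive. *)
Lemma exists_nonrepetitive : ok set0 -> ok setT ->
  exists c, nonrepetitive (fcol c).
Proof.
move=> ok0 okT; have := colourings_sub_le okT ok0 (sub0set _).
have c0 : [ffun=> ord0] \in colourings set0.
  apply/colouringsP; split; last by apply/vanishes_offP => x _; rewrite ffunE.
  move=> s _ s0 [t [t0 sz _]]; case: s s0 sz => [_ /= |x s s0]; first lia.
  by have := s0 x (mem_head _ _); rewrite inE.
move=> le0; have : (0 < #|colourings [set: G]|%:R :> R)%R.
  apply: lt_le_trans le0; rewrite mulr_gt0 ?exprn_gt0 // ltr0n card_gt0.
  by apply/set0Pn; exists [ffun=> ord0].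
rewrite ltr0n card_gt0 => /set0Pn[c /colouringsP[nr _]].
by exists c => s ps; apply: nr => // x _; rewrite inE.
Qed.

End Counting.

(** * Paths through a vertex when [Delta >= 2] *)

(** Cuts each list, which may be infinite, down to [k] numbered colours. *)
Lemma list_assignment_enum (k : nat) (G : sgraph) (C : Type)
    (L : G -> classical_sets.set C) : list_assignment k L ->
  exists f : G -> 'I_k -> C,
    (forall v, injective (f v)) /\ (forall v i, L v (f v i)).
Proof.
move=> Lk.
suff /choice[f fP] : forall v, exists g : 'I_k -> C,
    injective g /\ forall i, L v (g i).
  by exists f; split=> v; have [] := fP v.
move=> v; have /card_leP[g] := Lk v.
have inI (i : 'I_k) : nat_of_ord i \in `I_k by apply: mem_set; apply: ltn_ord.
exists (fun i => val (g (SigSub (inI i)))); split=> [i j|i].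
  move=> /val_inj/(@inj _ _ _ g _ _ (classical_sets.in_setT _)
    (classical_sets.in_setT _)) [] e.
  exact: val_inj.
exact: set_mem (valP (g (SigSub (inI i)))).
Qed.

Lemma is_path_split (G : sgraph) (v : G) (t1 t2 : seq G) :
  is_path (rev t1 ++ v :: t2) ->
  [/\ path (@edge G) v t1, path (@edge G) v t2, uniq (v :: t1),
      uniq (v :: t2) & ~~ has [in t1] t2].
Proof.
move=> /andP[]; rewrite cat_uniq rev_uniq /= !mem_rev negb_or.
move=> /and3P[u1 /andP[v1 dis] /andP[v2 u2]] srt.
have hs : ~~ has [in t1] t2.
  apply: contra dis => /hasP[x x2 x1].
  by apply/hasP; exists x; rewrite //= mem_rev.
rewrite v1 v2 u1 u2; split=> //.
  move: srt; rewrite -cat_rcons -rev_cons => /cat_sorted2[].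
  by rewrite rev_sorted /= (eq_path (e' := @edge G)) // => x y; exact: edge_sym.
move: srt; case: (rev t1) => [//|x t] /=.
by rewrite cat_path => /andP[_ /andP[]].
Qed.

Lemma sumn_le_mul (T : eqType) (s : seq T) (F : T -> nat) (m n : nat) :
  size s <= m -> {in s, forall x, F x <= n} -> sumn [seq F x | x <- s] <= m * n.
Proof.
move=> sm /allP H; apply: leq_trans (leq_mul sm (leqnn n)).
by elim: s {sm} H => //= x s IHs /andP[Fx /IHs Fs]; rewrite mulSn leq_add.
Qed.

Section Arms.

Variables (G : sgraph) (orig : pred G).

Definition nexts (p v : G) : seq G :=
  [seq x <- enum [pred w | edge v w] | x != p].

(** Walks without backtracking, rather than paths: a superset that can be counted step by step. The
    start [v] is left out, and [p] is the forbidden first step. *)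
Fixpoint arms (p v : G) (n : nat) : seq (seq G) :=
  if n is m.+1 then [seq x :: t | x <- nexts p v, t <- arms v x m]
  else [:: [::]].

Lemma mem_nexts p v x : (x \in nexts p v) = edge v x && (x != p).
Proof. by rewrite mem_filter mem_enum inE andbC. Qed.

Lemma mem_arms p v t : path (@edge G) v t -> uniq (v :: t) ->
  ohead t != Some p -> t \in arms p v (size t).
Proof.
elim: t p v => [|x t IHt] p v; first by rewrite inE.
rewrite [path _ _ _]/= => /andP[vx xt] /andP[vNxt ut] xp.
apply/allpairsPdep; exists x, t; rewrite mem_nexts vx; split=> //.
apply: IHt => //; move: vNxt; rewrite inE negb_or => /andP[_].
by case: (t) => //= y t'; rewrite inE negb_or eq_sym => /andP[].
Qed.

(** The arms of a path at [v] have [2k + 1] vertices in all, so exactly one arm is even; up to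
    reversal it is the first. The forbidden first steps are [a] and [b]. *)
Definition through (a b v : G) (k : nat) : seq (seq G) :=
  flatten [seq [seq rev t1 ++ v :: t2
    | t1 <- arms a v j.*2, t2 <- arms b v (k - j).*2.+1] | j <- iota 0 k.+1].

Lemma mem_through a b v k t1 t2 : is_path (rev t1 ++ v :: t2) ->
  ~~ odd (size t1) -> size t1 + size t2 = k.*2.+1 ->
  ohead t1 != Some a -> ohead t2 != Some b ->
  rev t1 ++ v :: t2 \in through a b v k.
Proof.
move=> /is_path_split[p1 p2 u1 u2 _] ev sz at1 bt2.
have e1 : size t1 = (size t1)./2.*2 by rewrite even_halfK.
have e2 : size t2 = (k - (size t1)./2).*2.+1 by lia.
apply/flattenP; exists [seq rev t ++ v :: t' | t <- arms a v (size t1)./2.*2,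
    t' <- arms b v (k - (size t1)./2).*2.+1].
  by apply/mapP; exists (size t1)./2 => //; rewrite mem_iota; lia.
apply/allpairsPdep; exists t1, t2.
by rewrite -e1 -e2 !mem_arms.
Qed.

(** At an original vertex the forbidden step is [v] itself, which excludes no neighbour. At a
    division vertex the two arms leave through different neighbours; forbidding one neighbour to
    each arm leaves at most one first step. *)
Definition paths_through (v : G) (k : nat) : seq (seq G) :=
  if orig v then through v v v k else
  let a := nth v (enum [pred w | edge v w]) 0 in
  let b := nth v (enum [pred w | edge v w]) 1 in
  through a b v k ++ through b a v k.

Hypothesis div_degree : forall x, ~~ orig x -> degree x <= 2.

Lemma paths_through_cover v k s : is_path s -> v \in s ->
  size s = 2 * k.+1 -> s \in paths_through v k \/ rev s \in paths_through v k.
Proof.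
move=> ps vs sz.
have main t1 t2 : is_path (rev t1 ++ v :: t2) -> ~~ odd (size t1) ->
    size t1 + size t2 = k.*2.+1 -> rev t1 ++ v :: t2 \in paths_through v k.
  move=> pt ev szt.
  have [p1 p2 /andP[v1 u1] /andP[v2 u2] dis] := is_path_split pt.
  have oh x t : x \notin t -> ohead t != Some x.
    by case: t => //= y t; rewrite inE negb_or eq_sym => /andP[].
  rewrite /paths_through; case: ifP => ov.
    by apply: mem_through; rewrite ?oh.
  set a := nth _ _ 0; set b := nth _ _ 1; rewrite mem_cat.
  (* If [v] has a single neighbour, [b] is the default [v], from which [x] differs. *)
  have nb x : edge v x -> x = a /\ x != b \/ x = b /\ x != a.
    move=> vx; have xv : x != v by apply: contraTneq vx => ->; rewrite edge_irr.
    have : x \in enum [pred w | edge v w] by rewrite mem_enum.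
    have := div_degree (negbT ov); have := enum_uniq [pred w | edge v w].
    rewrite /degree cardE /a /b.
    case: (enum _) => [|y [|z []]] //=; rewrite ?inE => + _.
      by move=> _ /eqP xy; left.
    by rewrite andbT => yz /orP[]/eqP->; [left|right]; rewrite // eq_sym.
  (* The odd arm is nonempty; its first vertex [y] is not on [t1] and decides which of the two lists
     contains the path. *)
  case: t2 szt p2 {v2} u2 dis pt => [|y t2] szt p2 u2 dis pt.
    by move: szt ev; rewrite addn0 => ->; rewrite /= odd_double.
  have yt1 : y \notin t1 by apply: contra dis => yt; rewrite /= yt.
  have /nb : edge v y by case/andP: p2.
  by case=> -[ey ny]; apply/orP; [left|right]; apply: mem_through => //;
    rewrite -ey oh.
case/splitPr: vs ps sz => s1 s2; rewrite -[s1]revK; set t1 := rev s1 => ps sz.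
have szt : size t1 + size s2 = k.*2.+1.
  by move: sz; rewrite size_cat size_rev /=; lia.
have [od|ev] := boolP (odd (size t1)); last by left; apply: main.
right; have er : rev (rev t1 ++ v :: s2) = rev s2 ++ v :: t1.
  by rewrite rev_cat rev_cons revK cat_rcons.
rewrite er; apply: main; first by rewrite -er is_path_rev.
  by have := congr1 odd szt; rewrite oddD od /= odd_double => ->.
by rewrite addnC.
Qed.

Lemma size_nexts p v : size (nexts p v) <= degree v.
Proof. by rewrite size_filter (leq_trans (count_size _ _)) // -cardE. Qed.

Lemma size_nexts_lt p v : edge v p -> size (nexts p v) < degree v.
Proof.
move=> vp; rewrite /nexts /degree cardE; set e := enum _.
have p_in : 0 < count (pred1 p) e by rewrite -has_count has_pred1 mem_enum.
rewrite -(count_predC (pred1 p) e) size_filter -add1n.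
exact: leq_add p_in (leqnn _).
Qed.

Lemma size_through a b v k m :
  (forall j, j <= k ->
    size (arms a v j.*2) * size (arms b v (k - j).*2.+1) <= m) ->
  size (through a b v k) <= k.+1 * m.
Proof.
move=> H; rewrite size_flatten /shape -map_comp; apply: sumn_le_mul.
  by rewrite size_iota.
move=> j; rewrite mem_iota => jk /=.
by rewrite size_allpairs; apply: H; lia.
Qed.

Variable D : nat.
Hypothesis D_gt0 : 0 < D.
Hypothesis orig_indep : forall x y, orig x -> edge x y -> ~~ orig y.
Hypothesis orig_degree : forall x, orig x -> degree x <= D.

(** Original vertices are independent, so at most every second step offers [D] choices; a division
    vertex entered from a neighbour has at most one continuation. Several division vertices in a row
    only delay the next branching. *)
Lemma size_arms n p v :
  (orig v -> size (arms p v n) <= D ^ uphalf n) /\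
  (~~ orig v -> size (nexts p v) <= 1 -> size (arms p v n) <= D ^ n./2).
Proof.
elim: n p v => [|n IHn] p v; first by rewrite /= expn0.
rewrite [arms _ _ _]/= size_allpairs_dep; split=> [ov|dv n1].
  rewrite [uphalf _]/= expnS; apply: sumn_le_mul.
    exact: leq_trans (size_nexts p v) (orig_degree ov).
  move=> x; rewrite mem_nexts => /andP[vx _].
  have dx := orig_indep ov vx.
  apply: (IHn v x).2 => //.
  rewrite -ltnS (leq_trans _ (div_degree dx)) // size_nexts_lt //.
  by rewrite edge_sym.
rewrite -[X in _ <= X]mul1n; apply: sumn_le_mul => // x.
rewrite mem_nexts => /andP[vx _].
have [ox|dx] := boolP (orig x); first exact: (IHn v x).1.
apply: leq_trans (_ : D ^ n./2 <= _).
  apply: (IHn v x).2 => //.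
  rewrite -ltnS (leq_trans _ (div_degree dx)) // size_nexts_lt //.
  by rewrite edge_sym.
by rewrite leq_pexp2l // (half_leq (leqnSn n)).
Qed.

(** The exponents of the two arms add up to [k + 1] at an original vertex and to [k] at a division
    vertex, where having two lists costs a factor 2, absorbed by [D]. *)
Lemma size_paths_through v k : 1 < D ->
  size (paths_through v k) <= k.+1 * D ^ k.+1.
Proof.
move=> D1; rewrite /paths_through; case: ifP => ov.
  apply: size_through => j jk.
  have -> : k.+1 = uphalf j.*2 + uphalf (k - j).*2.+1 by lia.
  by rewrite expnD leq_mul //; apply: (size_arms _ _ _).1.
set a := nth _ _ 0; set b := nth _ _ 1.
have [na nb] : size (nexts a v) <= 1 /\ size (nexts b v) <= 1.
  have := div_degree (negbT ov); rewrite /nexts /degree cardE /a /b.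
  by case: (enum _) => [|y [|z []]] //= _; rewrite !eqxx /=; do ?case: ifP.
have dv := negbT ov.
have sz a' b' : size (nexts a' v) <= 1 -> size (nexts b' v) <= 1 ->
    size (through a' b' v k) <= k.+1 * D ^ k.
  move=> na' nb'; apply: size_through => j jk.
  have -> : k = (j.*2)./2 + ((k - j).*2.+1)./2 by lia.
  have -> : ((j.*2)./2 + ((k - j).*2.+1)./2 - j) = k - j by lia.
  by rewrite expnD leq_mul //; apply: (size_arms _ _ _).2.
rewrite size_cat (leq_trans (leq_add (sz a b na nb) (sz b a nb na))) //.
by rewrite addnn -mul2n mulnCA leq_mul // expnS leq_mul.
Qed.

End Arms.

(** The bound is the full series [1 / (1 - 4/11)^2]; the induction is on a closed form of the
    partial sums. *)
Lemma sum_arith_geom (R : realFieldType) n :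
  (\sum_(k < n) k.+1%:R * (4 / 11) ^+ k <= 121 / 49 :> R)%R.
Proof.
have -> : (\sum_(k < n) k.+1%:R * (4 / 11) ^+ k =
    121 / 49 - (4 / 11) ^+ n * (n%:R * (11 / 7) + 121 / 49) :> R)%R.
  elim: n => [|n IHn]; first by rewrite big_ord0 expr0; ring.
  by rewrite big_ord_recr /= IHn exprS -natr1; field.
have q_ge0 : (0 <= (4 / 11 : R) ^+ n)%R by apply: exprn_ge0; lra.
rewrite gerBl; apply: mulr_ge0 => //; have := ler0n R n; lra.
Qed.

Lemma sparse_branching_choosable (R : realFieldType) (G : sgraph)
    (orig : pred G) (D m : nat) :
  1 < D ->
  (forall x y : G, orig x -> edge x y -> ~~ orig y) ->
  (forall x : G, orig x -> degree x <= D) ->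
  (forall x : G, ~~ orig x -> degree x <= 2) ->
  (261 / 50 * D%:R <= m%:R :> R)%R -> nonrep_choosable m G.
Proof.
move=> D1 indep odeg ddeg Dm C L; have D0 : 0 < D by lia.
have DR : (0 < D%:R :> R)%R by rewrite ltr0n.
case: m Dm => [|l] Dl /list_assignment_enum[f [f_inj fL]].
  lra.
(* For [beta = x D] the required list size is [D (x + x^2 / (x - 1)^2)], and [11/4] is close to the
   minimiser. *)
have b0 : (0 < 11 / 4 * D%:R :> R)%R by lra.
have [| | | | |//|//|c nr] := @exists_nonrepetitive G C l f f_inj
  (paths_through orig) (fun k => k.+1 * D ^ k.+1) xpredT R _ b0.
- by move=> v k; apply: size_paths_through.
- by move=> S v s k _ _ _ ps vs _; apply: paths_through_cover.
- by [].
- by move=> S B _ _ /properP[_ [x xS xB]]; exists x; rewrite // inE xB.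
- move=> n; apply: le_trans Dl.
  have -> : (\sum_(k < n) (k.+1 * D ^ k.+1)%:R / (11 / 4 * D%:R) ^+ k
      = D%:R * \sum_(k < n) k.+1%:R * (4 / 11) ^+ k :> R)%R.
    rewrite mulr_sumr; apply: eq_bigr => k _.
    rewrite natrM natrX exprMn exprS -[(4 / 11)%R]invf_div exprVn.
    have q0 : (11 / 4 != 0 :> R)%R by lra.
    by field; rewrite !expf_neq0 // gt_eqF.
  have := ler_wpM2l (ltW DR) (sum_arith_geom R n); lra.
by exists (fcol f c); split=> // v; apply: fL.
Qed.

(** * Disjoint unions of paths *)

Section Ranked.

(* [r] numbers the vertices of each component, a path, consecutively. *)
Variables (G : sgraph) (r : G -> nat).
Hypothesis r_adj : forall x y : G, edge x y -> r y = (r x).+1 \/ r x = (r y).+1.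
Hypothesis r_inj : forall x y z : G, edge x y -> edge x z -> r y = r z -> y = z.

Definition below : rel G := [rel x y | edge x y && (r y < r x)].

(** At the bottom of a component [low x] is [x], so a trajectory that runs too far repeats a vertex
    and is no path. *)
Definition low (x : G) : G := odflt x [pick y | below x y].

(** The family [ok] of this case: each component is filled from its lowest rank upwards. *)
Definition down_closed (S : {set G}) : bool :=
  [forall x in S, forall y, below x y ==> (y \in S)].

Lemma down_closedP (S : {set G}) :
  reflect (forall x y, x \in S -> below x y -> y \in S) (down_closed S).
Proof.
apply: (iffP forall_inP) => [H x y /H/forallP/(_ y)/implyP //|H x xS].
by apply/forallP => y; apply/implyP; apply: H.
Qed.

Lemma belowN x y : edge x y -> below x y || below y x.
Proof.
move=> xy; rewrite /below /= [edge y x]edge_sym xy /=.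
by have := r_adj xy; lia.
Qed.

Lemma below_inj x y z : below x y -> below x z -> y = z.
Proof.
move=> /andP[xy yx] /andP[xz zx]; apply: (r_inj xy xz).
by have := r_adj xy; have := r_adj xz; lia.
Qed.

Lemma above_inj x y z : below y x -> below z x -> y = z.
Proof.
move=> /andP[yx xy] /andP[zx xz]; apply: (@r_inj x); rewrite 1?edge_sym //.
by have := r_adj yx; have := r_adj zx; lia.
Qed.

Lemma below_low x y : below x y -> low x = y.
Proof.
move=> xy; rewrite /low; case: pickP => [z xz|/(_ y)]; last by rewrite xy.
exact: below_inj xz xy.
Qed.

(* A path of consecutively ranked vertices cannot turn around. *)
Lemma path_below v t : path (@edge G) v t -> uniq (v :: t) ->
  (forall y, ohead t = Some y -> below v y) -> path below v t.
Proof.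
elim: t v => //= x t IHt v /andP[vx xt] /andP[vNxt ut] hd.
have vbx := hd x erefl; rewrite -/(below v x) vbx; apply: IHt => //.
case: t xt vNxt {ut} => //= z t /andP[xz _] + y [<-].
rewrite !inE !negb_or => /and3P[_ vz _].
case/orP: (belowN xz) => // zx.
by rewrite (above_inj zx vbx) eqxx in vz.
Qed.

Lemma path_below_traject v t :
  path below v t -> v :: t = traject low v (size t).+1.
Proof.
elim: t v => //= x t IHt v /andP[/below_low vx /IHt xt].
by rewrite xt vx.
Qed.

Lemma path_below_pred v t y : path below v t -> y \in t ->
  exists2 z, z \in v :: t & below z y.
Proof.
elim: t v => //= x t IHt v /andP[vx xt]; rewrite inE => /orP[/eqP->|yt].
  by exists v; rewrite ?mem_head.
by have [z zt zy] := IHt x xt yt; exists z; rewrite // inE zt orbT.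
Qed.

Section Top.

Variables (S : {set G}) (v : G).
Hypotheses (dS : down_closed S) (dT : down_closed (v |: S)) (vS : v \notin S).

(** A neighbour above [v] lying in [S] would pull [v] into [S]. *)
Lemma top_below x : x \in v |: S -> edge v x -> below v x.
Proof.
move=> xT vx; have /orP[//|xv] := belowN vx.
case/negP: vS; apply: (down_closedP _ dS) xv.
move: xT; rewrite in_setU1 => /orP[/eqP xv|//].
by rewrite xv edge_irr in vx.
Qed.

(** If both arms at [v] were nonempty, both would start at the unique lower neighbour of [v]; hence
    [v] is an end of the path. *)
Lemma top_path s : is_path s -> v \in s -> {subset s <= v |: S} ->
  exists2 t, path below v t & s = v :: t \/ s = rev (v :: t).
Proof.
move=> ps vs; case/splitPr: vs ps => s1 s2.
rewrite -[s1]revK; set t1 := rev s1 => ps sT.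
have [p1 p2 u1 u2 dis] := is_path_split ps.
have hd t : path (@edge G) v t -> {subset t <= v |: S} ->
    forall y, ohead t = Some y -> below v y.
  case: t => //= x t /andP[vx _] tT y [<-].
  by apply: top_below vx; apply: tT; rewrite mem_head.
have T1 : {subset t1 <= v |: S}.
  by move=> x xt; apply: sT; rewrite mem_cat mem_rev xt.
have T2 : {subset s2 <= v |: S}.
  by move=> x xt; apply: sT; rewrite mem_cat inE xt !orbT.
have {}p1 := path_below p1 u1 (hd _ p1 T1).
have {}p2 := path_below p2 u2 (hd _ p2 T2).
case: (t1) p1 dis => [|x1 t1'] p1 dis; first by exists s2 => //; left.
case: (s2) p2 dis => [|x2 t2'] p2 dis.
  by exists (x1 :: t1') => //; right; rewrite [rev (v :: _)]rev_cons cats1.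
case/andP: p1 => p1 _; case/andP: p2 => p2 _.
by rewrite /= (below_inj p2 p1) mem_head in dis.
Qed.

(** A vertex just above a removed one is either above [v], hence outside [v |: S], or its
    predecessor on the path, hence removed too. *)
Lemma down_closed_top t n : path below v t -> 
  down_closed ((v |: S) :\: [set x in v :: take n t]).
Proof.
move=> /(take_path n) pt; apply/down_closedP => x y.
rewrite in_setD inE => /andP[xt xT] xy.
have yT := down_closedP _ dT _ _ xT xy.
rewrite in_setD yT andbT inE; apply: contra xt => yt.
move: yt; rewrite inE => /orP[/eqP yv|yt].
  have vx : edge v x by case/andP: xy; rewrite yv edge_sym.
  have /andP[_ l1] := top_below xT vx; case/andP: xy => _; rewrite yv; lia.
by have [z zt zy] := path_below_pred pt yt; rewrite (above_inj xy zy).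
Qed.

(** In either orientation the half containing [v] consists of [v] and the next [k] vertices down the
    path. *)
Lemma half_top s k : is_path s -> v \in s -> {subset s <= v |: S} ->
  size s = 2 * k.+1 -> down_closed ((v |: S) :\: [set x in path_half v k.+1 s]).
Proof.
move=> ps vs sT sz; have [t pt st] := top_path ps vs sT.
suff -> : [set x in path_half v k.+1 s] = [set x in v :: take k t].
  exact: down_closed_top.
case: st => es; rewrite es in sz ps *.
  by rewrite /path_half /= mem_head.
have szt : size (v :: t) = 2 * k.+1 by rewrite -sz size_rev.
have et : take k.+1 (rev (v :: t)) = rev (drop k.+1 (v :: t)).
  by rewrite take_rev szt; congr (rev (drop _ _)); lia.
have ed : drop k.+1 (rev (v :: t)) = rev (take k.+1 (v :: t)).
  by rewrite drop_rev szt; congr (rev (take _ _)); lia.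
rewrite /path_half et ed mem_rev ifF.
  by apply/setP => x; rewrite !inE mem_rev.
move: ps => /andP[+ _]; rewrite rev_uniq /= => /andP[vt _].
by apply: contraNF vt => /mem_drop.
Qed.

End Top.

(** A vertex of [S :\: B] of largest rank can go: a vertex of [S] just above it would also be
    outside [B], as [B] is down-closed, and would have larger rank. *)
Lemma down_closed_acc (S B : {set G}) : down_closed S -> down_closed B ->
  B \proper S -> exists2 x, x \in S :\: B & down_closed (S :\ x).
Proof.
move=> /down_closedP dS /down_closedP dB /properP[_ [x0 x0S x0B]].
have x0D : x0 \in S :\: B by rewrite inE x0B.
case: (@arg_maxnP _ x0 [in S :\: B] r x0D) => x xD xmax; exists x => //.
apply/down_closedP => y z; rewrite !in_setD1 => /andP[yx yS] yz.
rewrite (dS y) // andbT; apply: contraTneq yz => ->.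
apply/negP => ybx; move: xD; rewrite !inE => /andP[xB xS].
have yD : y \in S :\: B by rewrite inE yS andbT; apply: contra xB => /dB; apply.
by have := xmax y yD; case/andP: ybx => _; rewrite /=; lia.
Qed.

End Ranked.

Lemma sum_half_powers (R : realFieldType) n :
  (\sum_(k < n) 1%:R / 2 ^+ k <= 2 :> R)%R.
Proof.
have p_gt0 m : (0 < 2 ^+ m :> R)%R by apply: exprn_gt0; lra.
have -> : (\sum_(k < n) 1%:R / 2 ^+ k = 2 - 2 / 2 ^+ n :> R)%R.
  elim: n => [|n IHn]; first by rewrite big_ord0 expr0; field.
  by rewrite big_ord_recr /= IHn exprS; field; rewrite gt_eqF.
have : (0 < (2 ^+ n)^-1 :> R)%R by rewrite invr_gt0.
lra.
Qed.

Lemma ranked_choosable (G : sgraph) (r : G -> nat) (m : nat) :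
  (forall x y : G, edge x y -> r y = (r x).+1 \/ r x = (r y).+1) ->
  (forall x y z : G, edge x y -> edge x z -> r y = r z -> y = z) ->
  3 < m -> nonrep_choosable m G.
Proof.
move=> r_adj r_inj m3 C L.
case: m m3 => // l l3 /list_assignment_enum[f [f_inj fL]].
have b0 : (0 < 2 :> rat)%R by [].
(* A path with top end [v] only descends, so the trajectory of [low] is the one candidate for each
   order. *)
have [| | | | | | |c nr] := @exists_nonrepetitive G C l f f_inj
  (fun v k => [:: traject (low r) v (2 * k.+1)]) (fun=> 1)
  (down_closed r) _ _ b0.
- by [].
- move=> S v s k dS dT vS ps vs sT sz.
  have [t pt st] := top_path r_adj r_inj dS vS ps vs sT.
  have e : v :: t = traject (low r) v (2 * k.+1).
    rewrite (path_below_traject r_adj r_inj pt); congr (traject _ _ _).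
    by rewrite -sz; case: st => ->; rewrite ?size_rev.
  by rewrite -e !inE; case: st => ->; [left|right; rewrite revK].
- by move=> S v s k dS dT vS; apply: half_top.
- exact: down_closed_acc.
- move=> n; have := sum_half_powers rat n.
  have : (4 <= l.+1%:R :> rat)%R by rewrite ler_nat.
  lra.
- by apply/down_closedP => x y; rewrite inE.
- by apply/down_closedP => x y; rewrite !inE.
by exists (fcol f c); split=> // v; apply: fL.
Qed.

(** * Subdivisions *)

Lemma infix2_index (T : eqType) (s : seq T) (x y : T) : uniq s ->
  infix [:: x; y] s -> [/\ x \in s, y \in s & index y s = (index x s).+1].
Proof.
move=> us /infixP[p [q es]]; rewrite {}es in us *.
rewrite !mem_cat !inE !eqxx !orbT; split=> //.
move: us; rewrite cat_uniq /= !negb_or => /and3P[_ /and3P[xp yp _]].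
move=> /andP[/andP[xy _] _].
rewrite !index_cat (negPf xp) (negPf yp) /= eqxx (negPf xy) eqxx.
by rewrite addn0 addn1.
Qed.

Lemma set2_inj (T : finType) (v w v' w' : T) : v' != w' ->
  [set v; w] = [set v'; w'] -> (v' = v /\ w' = w) \/ (v' = w /\ w' = v).
Proof.
move=> ne e; have := set21 v' w'; have := set22 v' w'; rewrite -e.
move=> /set2P[]ew /set2P[]ev; rewrite ew ev ?eqxx in ne *; by [left|right|].
Qed.

Lemma card_le_size (T : finType) (A : pred T) (s : seq T) :
  (forall x, A x -> x \in s) -> #|A| <= size s.
Proof.
move=> As; apply: leq_trans (card_size s).
exact/subset_leq_card/subsetP.
Qed.

Section Subdivision.

Variables (H G : sgraph) (b : H -> G) (P : H -> H -> seq G).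
Hypothesis b_inj : injective b.
Hypothesis P_ok : forall v w, edge v w ->
  [/\ P w v = rev (P v w), 1 <= size (P v w), uniq (P v w)
    & forall u, b u \notin P v w].
Hypothesis P_disj : forall v w v' w' x, edge v w -> edge v' w' ->
  x \in P v w -> x \in P v' w' -> [set v; w]%SET = [set v'; w']%SET.
Hypothesis G_cover : forall x, (exists v, x = b v) \/
  (exists v w, edge v w /\ x \in P v w).
Hypothesis G_edge : forall x y, edge x y <->
  exists v w, edge v w /\ infix [:: x; y] (b v :: rcons (P v w) (b w)).

Definition edge_path v w : seq G := b v :: rcons (P v w) (b w).

Definition orig (x : G) : bool := [exists u, x == b u].

Lemma edge_neq v w : edge v w -> v != w :> H.
Proof. by move=> vw; apply: contraTneq vw => ->; rewrite edge_irr. Qed.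

Lemma edge_path_rev v w : edge v w -> edge_path w v = rev (edge_path v w).
Proof.
by move=> /P_ok[e _ _ _]; rewrite /edge_path e rev_cons rev_rcons rcons_cons.
Qed.

Lemma edge_path_uniq v w : edge v w -> uniq (edge_path v w).
Proof.
move=> vw; have [_ _ uP bP] := P_ok vw.
rewrite /edge_path /= rcons_uniq bP uP mem_rcons inE negb_or bP !andbT.
by rewrite (inj_eq b_inj) edge_neq.
Qed.

Lemma mem_edge_path_orig v w u :
  edge v w -> b u \in edge_path v w -> u = v \/ u = w.
Proof.
move=> /P_ok[_ _ _ bP].
rewrite /edge_path !inE mem_rcons inE (negPf (bP u)) orbF.
by rewrite !(inj_eq b_inj) => /orP[]/eqP; [left|right].
Qed.

Lemma mem_edge_path_div v w x : ~~ orig x -> x \in edge_path v w -> x \in P v w.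
Proof.
move=> /existsPn ox; rewrite /edge_path inE mem_rcons inE.
by rewrite (negPf (ox v)) (negPf (ox w)).
Qed.

Lemma div_mem x : ~~ orig x -> exists v w, edge v w /\ x \in P v w.
Proof.
by case: (G_cover x) => // -[v ->] /existsPn/(_ v); rewrite eqxx.
Qed.

(** A branch vertex is an end of every edge path through it, so its neighbour there is the nearest
    division vertex, which exists because [P v w] is nonempty. *)
Lemma edge_orig v y : edge (b v) y ->
  exists w, [/\ edge v w, y = head (b v) (P v w) & y \in P v w].
Proof.
move=> /G_edge[v' [w' [vw' ix]]].
have [vQ yQ iy] := infix2_index (edge_path_uniq vw') ix.
have [_ P0 uP bP] := P_ok vw'.
have ne : b v' != b w' by rewrite (inj_eq b_inj) edge_neq.
(* The last entry of an edge path has no successor, so [b v] must be the first. *)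
have [ev|ev] := mem_edge_path_orig vw' vQ; last first.
  have : index y (edge_path v' w') < size (edge_path v' w').
    by rewrite index_mem.
  rewrite iy ev /edge_path /= (negPf ne) size_rcons -cats1 index_cat.
  rewrite (negPf (bP _)) /=.
  by rewrite eqxx addn0 ltnn.
exists w'; rewrite -{}ev in vQ yQ iy P0 vw' *.
have ey : y = nth (b v) (edge_path v w') 1.
  by rewrite -[LHS](nth_index (b v) yQ) iy /edge_path /= eqxx.
move: P0 ey; rewrite /edge_path /=; case: (P v w') => //= z p _ ->.
by rewrite inE eqxx.
Qed.

Lemma orig_indep x y : orig x -> edge x y -> ~~ orig y.
Proof.
move=> /existsP[v /eqP->] /edge_orig[w [vw _ yP]].
apply/existsPn => u; apply: contraTneq yP => ->.
by have [_ _ _ ->] := P_ok vw.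
Qed.

Lemma orig_degree x : orig x -> degree x <= maxdeg H.
Proof.
move=> /existsP[v /eqP->]; apply: leq_trans (leq_bigmax v).
rewrite [X in _ <= X]/degree cardE -(size_map (fun w => head (b v) (P v w))).
apply: card_le_size => y /edge_orig[w [vw -> _]].
by apply: map_f; rewrite mem_enum.
Qed.

(** By [P_disj] a division vertex lies on one edge path up to reversal, and only the entries just
    before and after it are adjacent to it. *)
Lemma div_degree x : ~~ orig x -> degree x <= 2.
Proof.
move=> ox; have [v [w [vw xP]]] := div_mem ox.
pose s := edge_path v w; pose i := index x s.
apply: (@card_le_size _ _ [:: nth x s i.+1; nth x s i.-1]) => y.
move=> /G_edge[v' [w' [vw' ix]]].
have [xQ' _ _] := infix2_index (edge_path_uniq vw') ix.
have := P_disj vw vw' xP (mem_edge_path_div ox xQ').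
move=> /(set2_inj (edge_neq vw'))[[ev ew]|[ev ew]].
  rewrite {}ev {}ew in ix.
  have [_ yQ iy] := infix2_index (edge_path_uniq vw) ix.
  by rewrite -/i in iy; rewrite -iy nth_index // mem_head.
have {}ix : infix [:: y; x] (edge_path v w).
  move: ix; rewrite ev ew -/(edge_path w v) (edge_path_rev vw) -infix_rev.
  by rewrite revK.
have [yQ _ iy] := infix2_index (edge_path_uniq vw) ix.
by rewrite /i iy /= (nth_index _ yQ) !inE eqxx orbT.
Qed.

Section Matching.

Hypothesis deg1 : forall v w w' : H, edge v w -> edge v w' -> w = w'.

(** Each edge has two edge paths, reverses of each other; choosing one of them makes positions well
    defined. *)
Definition oriented (e : H * H) : bool :=
  edge e.1 e.2 && (enum_rank e.1 < enum_rank e.2).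

(** Since the edges of [H] are pairwise disjoint, the components of [G] are edge paths and isolated
    vertices; the latter get rank 0. *)
Definition rank (x : G) : nat :=
  if [pick e | oriented e && (x \in edge_path e.1 e.2)] is Some e
  then index x (edge_path e.1 e.2) else 0.

(** A shared division vertex identifies the edges by [P_disj], a shared branch vertex by [deg1]; the
    orientation then excludes the swapped pair. *)
Lemma oriented_uniq e e' x :
  oriented e -> oriented e' ->
  x \in edge_path e.1 e.2 -> x \in edge_path e'.1 e'.2 -> e = e'.
Proof.
case: e e' => [v w] [v' w'] /= /andP[/= vw lt] /andP[/= vw' lt'] xQ xQ'.
have [ox|ox] := boolP (orig x); last first.
  have := P_disj vw vw' (mem_edge_path_div ox xQ) (mem_edge_path_div ox xQ').
  move=> /(set2_inj (edge_neq vw'))[[-> ->]//|[ev ew]].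
  by rewrite ev ew ltnNge (ltnW lt) in lt'.
move: ox xQ xQ' => /existsP[u /eqP->].
move=> /(mem_edge_path_orig vw) xQ /(mem_edge_path_orig vw') xQ'.
have wv : edge w v by rewrite edge_sym.
have wv' : edge w' v' by rewrite edge_sym.
case: xQ xQ' => [ev|ew] [ev'|ew'].
- by congr (_, _); [rewrite -ev|apply: (@deg1 u); rewrite ?ev // -ev ev'].
- have e : w = v' by apply: (@deg1 u); [rewrite ev|rewrite ew'].
  by rewrite -e -ew' ev ltnNge (ltnW lt) in lt'.
- have e : v = w' by apply: (@deg1 u); [rewrite ew|rewrite ev'].
  by rewrite -e -ev' ew ltnNge (ltnW lt) in lt'.
- by congr (_, _); [apply: (@deg1 u); rewrite ?ew // -ew ew'|rewrite -ew].
Qed.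

Lemma rankE e x : oriented e -> x \in edge_path e.1 e.2 ->
  rank x = index x (edge_path e.1 e.2).
Proof.
move=> ue xe; rewrite /rank; case: pickP => [e' /andP[ue' xe']|/(_ e)].
  by rewrite (oriented_uniq ue ue' xe xe').
by rewrite ue xe.
Qed.

Lemma edge_oriented x y : edge x y -> exists e,
  [/\ oriented e, x \in edge_path e.1 e.2, y \in edge_path e.1 e.2
    & rank y = (rank x).+1 \/ rank x = (rank y).+1].
Proof.
move=> /G_edge[v [w [vw ix]]]; rewrite -/(edge_path v w) in ix.
have [xQ yQ iy] := infix2_index (edge_path_uniq vw) ix.
have [lt|lt|e] := ltngtP (enum_rank v) (enum_rank w).
- have u : oriented (v, w) by rewrite /oriented /= vw.
  by exists (v, w); rewrite /= xQ yQ !(rankE u) // iy; split=> //; left.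
- have wv : edge w v by rewrite edge_sym.
  have u : oriented (w, v) by rewrite /oriented /= wv.
  have {}ix : infix [:: y; x] (edge_path w v).
    by rewrite (edge_path_rev vw) -infix_rev !revK.
  have [{}yQ {}xQ {}iy] := infix2_index (edge_path_uniq wv) ix.
  by exists (w, v); rewrite /= xQ yQ !(rankE u) // iy; split=> //; right.
- by have := edge_neq vw; rewrite (enum_rank_inj (val_inj e)) eqxx.
Qed.

Lemma rank_adj x y : edge x y -> rank y = (rank x).+1 \/ rank x = (rank y).+1.
Proof. by move=> /edge_oriented[e []]. Qed.

Lemma rank_inj x y z : edge x y -> edge x z -> rank y = rank z -> y = z.
Proof.
move=> /edge_oriented[e [ue xe ye _]] /edge_oriented[e' [ue' xe' ze _]].
rewrite -(oriented_uniq ue ue' xe xe') in ze.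
rewrite (rankE ue ye) (rankE ue ze) => ei.
by rewrite -(nth_index x ye) ei nth_index.
Qed.

End Matching.

End Subdivision.

Lemma subdivision_choosable (R : realFieldType) (H G : sgraph) (m : nat) :
  0 < maxdeg H -> is_subdivision 1 H G ->
  (261 / 50 * (maxdeg H)%:R <= m%:R :> R)%R -> nonrep_choosable m G.
Proof.
move=> D0 [b [P [b_inj P_ok P_disj G_cover G_edge]]] Dm.
have [D1|D1|D1] := ltngtP (maxdeg H) 1; first by lia.
  apply: sparse_branching_choosable D1 _ _ _ Dm.
  - exact: orig_indep P_ok G_edge.
  - exact: orig_degree P_ok G_edge.
  - exact: div_degree P_ok P_disj G_cover G_edge.
have deg1 (v w w' : H) : edge v w -> edge v w' -> w = w'.
  move=> vw vw'.
  have : degree v <= 1 by rewrite -D1; apply: leq_bigmax.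
  by move=> /card_le1_eqP; apply; rewrite inE.
apply: (@ranked_choosable G (rank b P)).
- exact: rank_adj.
- exact: rank_inj.
(* With [maxdeg H = 1] the bound reads [5.22 <= m], which leaves room for four colours. *)
move: Dm; rewrite D1 mulr1 -(ltr_nat R); lra.
Qed.

Theorem theorem84 (Delta : nat) (H G : sgraph) :
  (0 < Delta)%N ->
  maxdeg H = Delta ->
  is_subdivision 1 H G ->
  ((pi_ch G)%:Z <= Num.ceil (5.22%Q * Delta%:R))%R.
Proof.
move=> Delta_gt0 eDelta sub.
have -> : (5.22%Q = 261 / 50 :> rat)%R by apply/eqP; vm_compute.
set c := Num.ceil _.
have c_ge : (261 / 50 * Delta%:R <= c%:~R :> rat)%R.
  exact: Num.Theory.ceil_ge.
have c_ge0 : (0 <= c)%R.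
  rewrite -(ler_int rat); apply: le_trans c_ge.
  by apply: mulr_ge0 (ler0n _ _); apply: divr_ge0; apply: ler0n.
(* Once the ceiling is a natural number, minimality of [pi_ch] reduces the bound to choosability
   with that many colours. *)
have em : c = (`|c|%N%:Z)%R by rewrite gez0_abs.
rewrite em in c_ge *; rewrite lez_nat /pi_ch.
case: ex_minnP => n _; apply; apply/asboolP.
by apply: (subdivision_choosable _ sub); rewrite eDelta; [|exact: c_ge].
Qed.
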